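(* Let $N$ be a positive integer. The noncommutative Schur function $\mathfrak{J}_\lambda(\mathbf{u})$ is a positive sum of monomials in $\mathcal{U}/I_{\mathrm{KR}}^{\mathrm{st}}$ when $\lambda$ is a hook shape $(a,1^b)$, or of the form $(a,2)$ (with $a\ge 2$), or of the form $(2,2,1^a)$ (with $a\ge 0$).
   Context: $\mathcal{U}=\mathbb{Z}\langle u_1,\dots,u_N\rangle$ is the free associative algebra in noncommuting variables; we write the letter $a$ for $u_a$, so monomials are words in the alphabet $\{1,\dots,N\}$. $I_{\mathrm{KR}}^{\mathrm{st}}$ is the two-sided ideal of $\mathcal{U}$ generated by $b(ac-ca)-(ac-ca)b$ for all letters $a<b<c$, and by all words having a repeated letter. For $d>0$, $e_d(\mathbf{u})=\sum_{N\ge i_1>i_2>\cdots>i_d\ge 1}u_{i_1}\cdots u_{i_d}$, $e_0(\mathbf{u})=1$, $e_d(\mathbf{u})=0$ for $d<0$. For a partition $\lambda$ with conjugate $\lambda'=(\lambda'_1,\dots,\lambda'_t)$ ($t=\lambda_1$), $\mathfrak{J}_\lambda(\mathbf{u})=\sum_{\pi\in S_t}\mathrm{sgn}(\pi)\,e_{\lambda'_1+\pi(1)-1}(\mathbf{u})\cdots e_{\lambda'_t+\pi(t)-t}(\mathbf{u})\in\mathcal{U}$. An element $z$ is a positive sum of monomials in $\mathcal{U}/I$ if $z\equiv \sum_k c_k w_k \pmod I$ for some words $w_k$ and integers $c_k\ge 0$. *)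

(* Defs.v *)
From mathcomp Require Import all_boot all_order all_fingroup all_algebra.
From mathcomp Require Import monalg.

Set Implicit Arguments.
Unset Strict Implicit.
Unset Printing Implicit Defensive.

Import GRing.Theory.
Local Open Scope ring_scope.

(* The free associative algebra Z<u_1, ..., u_N> as the monoid algebra over
   int of the free monoid on 'I_N; the ordinal i stands for the letter i + 1. *)
Notation free_alg N := {malg int[{fmonom 'I_N}]}.

Definition letter (N : nat) (i : 'I_N) : free_alg N := << fmu i >>.

Definition word (N : nat) (w : seq 'I_N) : free_alg N :=
  \prod_(i <- w) letter i.

Inductive ideal_gen (R : nzRingType) (G : R -> Prop) : R -> Prop :=
| ideal_gen_base x : G x -> ideal_gen G x
| ideal_gen0 : ideal_gen G 0
| ideal_genD x y : ideal_gen G x -> ideal_gen G y -> ideal_gen G (x + y)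
| ideal_genMl r x : ideal_gen G x -> ideal_gen G (r * x)
| ideal_genMr r x : ideal_gen G x -> ideal_gen G (x * r).

Inductive KRst_gen (N : nat) : free_alg N -> Prop :=
| KRst_gen_comm (a b c : 'I_N) : (a < b)%N -> (b < c)%N ->
    KRst_gen (word [:: b] * (word [:: a; c] - word [:: c; a])
              - (word [:: a; c] - word [:: c; a]) * word [:: b])
| KRst_gen_repeat (w : seq 'I_N) : ~~ uniq w -> KRst_gen (word w).

Definition I_KRst (N : nat) : free_alg N -> Prop := ideal_gen (@KRst_gen N).

(* For d = 0 the sum has the empty tuple as its only index, hence equals 1. *)
Definition elem (N : nat) (d : int) : free_alg N :=
  match d with
  | Posz n => \sum_(s : n.-tuple 'I_N | sorted (fun i j : 'I_N => (j < i)%N) s)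
      word s
  | Negz _ => 0
  end.

Definition is_partition (la : seq nat) : bool :=
  sorted geq la && (0%N \notin la).

(* Length of column j of the diagram (columns numbered from 0): the part
   la'_{j+1} of the conjugate partition, which has head 0 la = la_1 parts. *)
Definition conj_part (la : seq nat) (j : nat) : nat :=
  count (fun p => (j < p)%N) la.

(* Indices start at 0, so that la'_i + pi(i) - i is unaffected by the shift. *)
Definition ncschur (N : nat) (la : seq nat) : free_alg N :=
  \sum_(p : 'S_(head 0%N la))
    (-1) ^+ p *
    \prod_(i < head 0%N la)
      elem N ((conj_part la i)%:Z + (p i : nat)%:Z - (i : nat)%:Z).

Definition positive_monomial_sum_mod (N : nat) (I : free_alg N -> Prop)
    (z : free_alg N) : Prop :=
  exists cw : seq (nat * seq 'I_N),
    I (z - \sum_(t <- cw) word t.2 *+ t.1).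

(* Main.v *)
(* Modulo the ideal every word with a repeated letter vanishes, so the complete
   symmetric function h_d becomes the sum g_d of strictly increasing words.
   Adding one letter x smaller than all letters of an alphabet s gives
   e_d(x,s) = e_d + e_{d-1} x and g_d(x,s) = g_d + x g_{d-1}, and everything is
   proved by induction on the alphabet with these two recursions.
   - Hooks: the Jacobi-Trudi determinant is P(p,q) = sum_j (-1)^j e_{p+j} g_{q-j},
     and P(p,q)(x,s) = P(p,q)(s) + e_{p-1} x g_q because the sum telescopes.
   - (a,2): expanding the determinant along its first column and using that e_1
     commutes with every e_d, it becomes g_2 g_a - g_1 g_{a+1}.  The relation,
     summed over the largest letter, reads
     y g_1 x + x g_1 y = y x g_1 + g_1 x y for x < y < s.  Adding x to the alphabet
     increases g_2 g_a - g_1 g_{a+1} by an expression W(x,s), and by the relation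
     W(x,ys) = W(x,s) + g_2 x y g_{a-2} + y x (g_1 g_{a-1} - g_a), where
     g_1 g_{a-1} - g_a = P(2,a-2).
   - (2,2,1^a): the determinant is e_{a+2} e_2 - e_{a+3} e_1, which is the previous
     expression read backwards; the ideal is stable under reversal of words. *)
Require Import Defs.
From mathcomp Require Import all_boot.
From Stdlib Require Setoid Morphisms Ncring Ncring_tac.
From mathcomp Require Import all_order all_fingroup all_algebra.
From mathcomp Require Import monalg.

Set Implicit Arguments.
Unset Strict Implicit.
Unset Printing Implicit Defensive.

Import GRing.Theory.

(** * Elementary and complete sums, and determinants over a noncommutative ring *)

Section NoncommutativeSymmetricFunctions.
Local Open Scope ring_scope.

Variables (R : nzRingType) (T : Type) (u : T -> R) (I : R -> Prop).

(* For an increasing list s: the sums of the strictly decreasing, resp. strictly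
   increasing, words of length d with letters in s. *)
Fixpoint esf (s : seq T) (d : nat) : R :=
  match d, s with
  | 0, _ => 1
  | _.+1, [::] => 0
  | d'.+1, x :: s' => esf s' d + esf s' d' * u x
  end.

Fixpoint gsf (s : seq T) (d : nat) : R :=
  match d, s with
  | 0, _ => 1
  | _.+1, [::] => 0
  | d'.+1, x :: s' => gsf s' d + u x * gsf s' d'
  end.

(* f 0 h_q - f 1 h_(q-1) + ... + (-1)^q f q; the last term is f q, not f q h_0. *)
Fixpoint hessenberg_sum (f : nat -> R) (h : nat -> R) (q : nat) : R :=
  if q is q'.+1 then f 0 * h q - hessenberg_sum (fun j => f j.+1) h q' else f 0.

(** Positivity as closure rules: products and congruences need no explicit list of words.
    [monpos_positive_monomial_sum] extracts the list at the end. *)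
Inductive monpos : R -> Prop :=
| monpos0 : monpos 0
| monpos1 : monpos 1
| monpos_letter i : monpos (u i)
| monposD x y : monpos x -> monpos y -> monpos (x + y)
| monposM x y : monpos x -> monpos y -> monpos (x * y)
| monpos_eqm x y : monpos x -> I (y - x) -> monpos y.

Lemma esf0 s : esf s 0 = 1. Proof. by case: s. Qed.
Lemma gsf0 s : gsf s 0 = 1. Proof. by case: s. Qed.
Lemma esf_nil d : esf [::] d.+1 = 0. Proof. by []. Qed.
Lemma gsf_nil d : gsf [::] d.+1 = 0. Proof. by []. Qed.

Lemma esf_cons x s d : esf (x :: s) d.+1 = esf s d.+1 + esf s d * u x.
Proof. by []. Qed.

Lemma gsf_cons x s d : gsf (x :: s) d.+1 = gsf s d.+1 + u x * gsf s d.
Proof. by []. Qed.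

Lemma esf1 s : esf s 1 = gsf s 1.
Proof.
elim: s => [//|x s IHs].
by rewrite esf_cons gsf_cons IHs esf0 gsf0 mulr1 mul1r.
Qed.

Lemma monpos_esf s d : monpos (esf s d).
Proof.
elim: s d => [|x s IHs] [|d] /=; [exact: monpos1 | exact: monpos0 | exact: monpos1 |].
exact: monposD (IHs _) (monposM (IHs _) (monpos_letter _)).
Qed.

Lemma monpos_gsf s d : monpos (gsf s d).
Proof.
elim: s d => [|x s IHs] [|d] /=; [exact: monpos1 | exact: monpos0 | exact: monpos1 |].
exact: monposD (IHs _) (monposM (monpos_letter _) (IHs _)).
Qed.

(* Modulo the ideal this is the Schur function of the hook (q + 1, 1^(p - 1)). *)
Definition hook_schur s p q := hessenberg_sum (fun j => esf s (p + j)) (gsf s) q.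

Lemma hook_schur0 s p : hook_schur s p 0 = esf s p.
Proof. by rewrite /hook_schur /= addn0. Qed.

(** The test is essential: truncated subtraction would give [esf s 0 = 1] where a negative index
    must give 0. *)
Definition ecoef s (i j : nat) : R := if (i <= j)%N then esf s (j - i) else 0.

Lemma ecoefSS s i j : ecoef s i.+1 j.+1 = ecoef s i j.
Proof. by rewrite /ecoef subSS. Qed.

(* The Jacobi-Trudi matrix of a shape whose columns other than the first have
   length 1, with its first row replaced by f. *)
Definition jt_tail s (f : nat -> R) (i j : nat) : R :=
  if i is i'.+1 then ecoef s i' j else f j.

Definition noncomm_det n (A : nat -> nat -> R) : R :=
  \sum_(p : 'S_n) (-1) ^+ p * \prod_(i < n) A i (p i).

Lemma eq_noncomm_det n (A B : nat -> nat -> R) :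
  (forall i j, (i < n)%N -> (j < n)%N -> A i j = B i j) ->
  noncomm_det n A = noncomm_det n B.
Proof.
move=> eqAB; apply: eq_bigr => p _; congr (_ * _).
by apply: eq_bigr => i _; rewrite eqAB.
Qed.

Lemma noncomm_det1 (A : nat -> nat -> R) : noncomm_det 1 A = A 0 0.
Proof.
rewrite /noncomm_det (big_pred1 1%g) => [|p].
  by rewrite odd_perm1 mul1r big_ord1 perm1.
by rewrite /=; apply/esym/eqP/permP=> i; rewrite perm1 !ord1.
Qed.

Lemma prod_eq0 n (F : 'I_n -> R) i : F i = 0 -> \prod_(k < n) F k = 0.
Proof.
move=> Fi0; elim: (index_enum 'I_n) (mem_index_enum i) => // k s IHs.
rewrite big_cons !inE; case: eqP => [<- _ | _ /IHs ->]; last by rewrite mulr0.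
by rewrite Fi0 mul0r.
Qed.

Lemma big_perm_lift n (i0 j0 : 'I_n.+1) (F : 'S_n.+1 -> R) :
  \sum_(p : 'S_n.+1 | p i0 == j0) F p = \sum_(p : 'S_n) F (lift_perm i0 j0 p).
Proof.
have inj_lift : injective (lift_perm i0 j0).
  move=> p q epq; apply/permP=> k; apply: (@lift_inj _ j0).
  by rewrite -!(lift_perm_lift i0) epq.
rewrite -(big_imset (A := predT)) /=; last by move=> p q _ _; apply: inj_lift.
apply: eq_bigl => p; apply/eqP/imsetP => [pi0 | [q _ ->]]; last exact: lift_perm_id.
have liftE k : {k' | p (lift i0 k) = lift j0 k'}.
  have := neq_lift i0 k; rewrite -(inj_eq (@perm_inj _ p)) pi0.
  by case/unlift_some=> k' ? _; exists k'.
have inj_f : injective (fun k => sval (liftE k)).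
  move=> k1 k2 /(congr1 (lift j0)); rewrite -!(svalP (liftE _)).
  by move/perm_inj/lift_inj.
exists (perm inj_f) => //; apply/permP=> k; case: (unliftP i0 k) => [k'|] ->.
  by rewrite lift_perm_lift permE -(svalP (liftE k')).
by rewrite lift_perm_id.
Qed.

(* The factor from row 0 precedes the one from row 1 in every product, hence the
   unusual first row of the second minor. *)
Lemma noncomm_det_col0 n (A : nat -> nat -> R) : (forall i, A i.+2 0 = 0) ->
  noncomm_det n.+2 A =
  A 0 0 * noncomm_det n.+1 (fun i j => A i.+1 j.+1)
  - noncomm_det n.+1
      (fun i j => if i is i'.+1 then A i'.+2 j.+1 else A 0 j.+1 * A 1 0).
Proof.
move=> A0.
pose one := lift ord0 (ord0 : 'I_n.+1).
rewrite /noncomm_det (bigID (fun p : 'S_n.+2 => p ord0 == ord0)) /=; congr (_ + _).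
  rewrite big_perm_lift mulr_sumr; apply: eq_bigr => p _.
  rewrite odd_lift_perm /= big_ord_recl lift_perm_id /=.
  rewrite [LHS]mulrA -commr_sign -mulrA; congr (_ * (_ * _)).
  by apply: eq_bigr => i _; rewrite lift_perm_lift.
(* Permutations taking column 0 in neither row 0 nor row 1 take it in a lower row, where the entry
   vanishes. *)
rewrite (bigID (fun p : 'S_n.+2 => p one == ord0)) /= [X in _ + X]big1 ?addr0.
  rewrite (eq_bigl (fun p : 'S_n.+2 => p one == ord0)); last first.
    move=> p; have [p1|_] := eqVneq (p one) ord0; rewrite ?andbF // andbT.
    by apply/eqP=> /esym/(etrans p1); apply/eqP; rewrite (inj_eq perm_inj).
  rewrite big_perm_lift -sumrN; apply: eq_bigr => p _.
  rewrite odd_lift_perm /= signrN mulNr; congr (- (_ * _)).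
  rewrite 2!big_ord_recl [in RHS]big_ord_recl /= mulrA.
  have -> : lift_perm one ord0 p ord0 = lift ord0 (p ord0).
    by rewrite -(lift_perm_lift one); congr (lift_perm one ord0 p _); apply: val_inj.
  have -> : lift_perm one ord0 p one = ord0 by rewrite lift_perm_id.
  congr (_ * _); apply: eq_bigr => i _.
  have -> // : lift_perm one ord0 p (lift ord0 (lift ord0 i))
               = lift ord0 (p (lift ord0 i)).
  by rewrite -(lift_perm_lift one); congr (lift_perm one ord0 p _); apply: val_inj.
move=> p /andP[p0 p1]; pose i := (p^-1)%g ord0.
have pi : p i = ord0 by rewrite permKV.
rewrite (@prod_eq0 _ _ i) ?mulr0 // pi.
case: i pi => [[|[|i]] lti] pi //=.
  by case/eqP: p0; rewrite -[RHS]pi; congr (p _); apply: val_inj.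
by case/eqP: p1; rewrite -[RHS]pi; congr (p _); apply: val_inj.
Qed.

End NoncommutativeSymmetricFunctions.

Arguments monpos0 {R T u I}.
Arguments monpos1 {R T u I}.
Arguments monpos_letter {R T u I} i.
Arguments monpos_esf {R T u I} s d.
Arguments monpos_gsf {R T u I} s d.

(** * Congruences modulo an ideal containing the defining relations *)

Section Congruence.
(* Imported locally: the notations of Ncring hijack the numerals 0 and 1. *)
Import Setoid Morphisms Ncring Ncring_tac.
Local Open Scope ring_scope.

Variables (R : nzRingType) (T : Type) (u : T -> R) (lt : rel T) (I : R -> Prop).

Local Notation esf := (esf u).
Local Notation gsf := (gsf u).
Local Notation hook_schur := (hook_schur u).
Local Notation jt_tail := (jt_tail u).
Local Notation ecoef := (ecoef u).
Local Notation monpos := (monpos u I).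

Hypothesis I0 : I 0.
Hypothesis ID : forall x y, I x -> I y -> I (x + y).
Hypothesis IMl : forall r x, I x -> I (r * x).
Hypothesis IMr : forall r x, I x -> I (x * r).
Hypothesis I_repeat : forall a x, I (u a * x * u a).
Hypothesis I_comm : forall a b c, lt a b -> lt b c ->
  I (u b * (u a * u c - u c * u a) - (u a * u c - u c * u a) * u b).

Definition eqm (x y : R) := I (x - y).
Notation "x === y" := (eqm x y) (at level 70).

Lemma I_opp x : I x -> I (- x).
Proof. by rewrite -mulN1r; apply: IMl. Qed.

Local Instance eqm_equiv : Equivalence eqm.
Proof.
split=> [x | x y Ixy | x y z Ixy Iyz]; rewrite /eqm.
- by rewrite subrr.
- by rewrite -opprB; apply: I_opp.
- by rewrite -(subrKA y); apply: ID.
Qed.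

Local Instance eqm_add : Proper (eqm ==> eqm ==> eqm) +%R.
Proof. by move=> x y Ixy a b Iab; rewrite /eqm opprD addrACA; apply: ID. Qed.

Local Instance eqm_mul : Proper (eqm ==> eqm ==> eqm) *%R.
Proof.
move=> x y Ixy a b Iab; rewrite /eqm -(subrKA (y * a)) -mulrBl -mulrBr.
by apply: ID; [apply: IMr | apply: IMl].
Qed.

Local Instance eqm_opp : Proper (eqm ==> eqm) -%R.
Proof. by move=> x y Ixy; rewrite /eqm -opprD; apply: I_opp. Qed.

(* Makes non_commutative_ring decide ring identities up to the congruence. *)
Local Instance eqm_ops : @Ring_ops R 0 1 +%R *%R (fun x y => x - y) -%R eqm := {}.

Local Instance eqm_ring : Ring (Ro := eqm_ops).
Proof.
have eqmE x y : x = y -> eqm x y by move=> ->; reflexivity.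
split; try exact _; rewrite /equality /eq_notation => *;
  rewrite ?/addition ?/add_notation ?/multiplication ?/mul_notation
          ?/subtraction ?/sub_notation ?/opposite ?/opp_notation.
- by move=> x y Ixy a b Iab; apply: eqm_add => //; apply: eqm_opp.
- exact/eqmE/add0r.
- exact/eqmE/addrC.
- exact/eqmE/addrA.
- exact/eqmE/mul1r.
- exact/eqmE/mulr1.
- exact/eqmE/mulrA.
- exact/eqmE/mulrDl.
- exact/eqmE/mulrDr.
- reflexivity.
- exact/eqmE/subrr.
Qed.

Lemma eqm_repeat a x : u a * x * u a === 0.
Proof. by rewrite /eqm subr0. Qed.

Lemma eqm_repeat2 a : u a * u a === 0.
Proof. by have := eqm_repeat a 1; rewrite mulr1. Qed.

Lemma monpos_sum x y z : monpos x -> monpos y -> z === x + y -> monpos z.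
Proof. by move=> Px Py; apply: monpos_eqm; apply: monposD. Qed.

Lemma eq_hessenberg_sum f f' h h' q :
  (forall j, f j === f' j) -> (forall j, h j === h' j) ->
  hessenberg_sum f h q === hessenberg_sum f' h' q.
Proof.
move=> + eqh; elim: q f f' => [|q IHq] f f' eqf /=; first exact: eqf.
rewrite -> (eqf 0), (eqh q.+1), (IHq _ (fun j => f' j.+1)); first reflexivity.
by move=> j; exact: eqf.
Qed.

Lemma hook_schurS s p q :
  hook_schur s p q.+1 === esf s p * gsf s q.+1 - hook_schur s p.+1 q.
Proof.
rewrite /hook_schur /= addn0.
setoid_rewrite -> (@eq_hessenberg_sum _ (fun j => esf s (p.+1 + j)) (gsf s) (gsf s) q).
- reflexivity.
- by move=> j; rewrite addnS; reflexivity.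
- by move=> j; reflexivity.
Qed.

Lemma hook_schur_cons x s p q :
  hook_schur (x :: s) p.+1 q === hook_schur s p.+1 q + esf s p * u x * gsf s q.
Proof.
elim: q p => [|q IHq] p.
  rewrite !hook_schur0 esf_cons gsf0; non_commutative_ring.
rewrite -> !hook_schurS, IHq; rewrite esf_cons gsf_cons.
(* Pattern of the later proofs too: an exact ring identity exhibits the error terms, here one
   containing [u x * u x], and rewriting then kills them. *)
transitivity (esf s p.+1 * gsf s q.+1 - hook_schur s p.+2 q +
  esf s p * u x * gsf s q.+1 + esf s p * (u x * u x) * gsf s q).
  non_commutative_ring.
rewrite -> eqm_repeat2; non_commutative_ring.
Qed.

Lemma hook_schur_nil p q : hook_schur [::] p.+1 q === 0.
Proof.
elim: q p => [|q IHq] p; first by rewrite hook_schur0; reflexivity.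
rewrite -> hook_schurS, IHq; rewrite esf_nil; non_commutative_ring.
Qed.

Lemma monpos_hook_schur s p q : monpos (hook_schur s p.+1 q).
Proof.
elim: s => [|x s IHs].
  by apply: monpos_eqm monpos0 _; exact: hook_schur_nil.
apply: monpos_sum IHs _ (hook_schur_cons _ _ _ _).
by apply: monposM (monpos_gsf _ _); apply: monposM (monpos_esf _ _) (monpos_letter _).
Qed.

(** This is the classical relation between elementary and complete functions, the alternating sum of
    e_j h_(d-j) being 0, for d = q + 1. *)
Lemma hook_schur1 s q : hook_schur s 1 q === gsf s q.+1.
Proof.
elim: s => [|x s IHs]; first exact: hook_schur_nil.
rewrite -> hook_schur_cons, IHs; rewrite gsf_cons esf0 mul1r; reflexivity.
Qed.

Lemma hook_schur2 s q : hook_schur s 2 q === gsf s 1 * gsf s q.+1 - gsf s q.+2.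
Proof.
rewrite <- (hook_schur1 s q.+1), hook_schurS; rewrite esf1; non_commutative_ring.
Qed.

(** Stated as a vanishing expression so that rewriting can delete it inside larger sums. *)
Lemma eqm_comm1 x y s : lt x y -> all (lt y) s ->
  u y * esf s 1 * u x + u x * esf s 1 * u y
  - u y * u x * esf s 1 - esf s 1 * u x * u y === 0.
Proof.
move=> ltxy; elim: s => [_|z s IHs /= /andP[ltyz lts]].
  rewrite esf_nil; non_commutative_ring.
rewrite esf0 mul1r; have {}IHs := IHs lts.
have xyz : u y * (u x * u z - u z * u x) - (u x * u z - u z * u x) * u y === 0.
  by rewrite /eqm subr0; apply: I_comm.
transitivity (
  (u y * esf s 1 * u x + u x * esf s 1 * u y
   - u y * u x * esf s 1 - esf s 1 * u x * u y)
  - (u y * (u x * u z - u z * u x) - (u x * u z - u z * u x) * u y)).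
  non_commutative_ring.
rewrite -> IHs, xyz; non_commutative_ring.
Qed.

(** Up to repeated letters and commutators over s, this is the commutator of e_1 and e_(d+1) over x
    :: s. Splitting off the least letter y of s leaves two instances over the rest, a multiple of
    [eqm_comm1], and words with a repeated letter. *)
Lemma esf_letter_comm x s d : pairwise lt (x :: s) ->
  u x * esf s d.+1 - esf s d.+1 * u x
  + esf s d * esf s 1 * u x - esf s d * u x * esf s 1 === 0.
Proof.
elim: s d => [|y r IHr] [|d] /=; try by rewrite ?esf0 => _; non_commutative_ring.
case/and3P=> /andP[ltxy ltxr] ltyr prr.
have /= := IHr _; rewrite ltxr prr => /(_ _ isT) {}IHr.
rewrite esf0 mul1r.
transitivity (
  (u x * esf r d.+2 - esf r d.+2 * u x
   + esf r d.+1 * esf r 1 * u x - esf r d.+1 * u x * esf r 1)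
  + (u x * esf r d.+1 - esf r d.+1 * u x
   + esf r d * esf r 1 * u x - esf r d * u x * esf r 1) * u y
  + esf r d * (u y * esf r 1 * u x + u x * esf r 1 * u y
  - u y * u x * esf r 1 - esf r 1 * u x * u y)
  + esf r d * (u y * u y) * u x - esf r d * (u y * u x * u y)).
  non_commutative_ring.
rewrite -> !IHr, (eqm_comm1 ltxy ltyr), eqm_repeat, eqm_repeat2.
non_commutative_ring.
Qed.

Lemma esf1_comm s d : pairwise lt s -> esf s 1 * esf s d === esf s d * esf s 1.
Proof.
elim: s d => [|x s IHs] [|d]; try by rewrite ?esf0 => _; non_commutative_ring.
move=> prxs; have xs := esf_letter_comm d prxs.
have {}IHs : forall d, esf s 1 * esf s d === esf s d * esf s 1.
  by move=> d0; apply: IHs; move: prxs; rewrite pairwise_cons => /andP[].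
rewrite !esf_cons esf0 mul1r.
transitivity (esf s 1 * esf s d.+1 + (esf s 1 * esf s d) * u x
  + u x * esf s d.+1 + u x * esf s d * u x); first non_commutative_ring.
rewrite -> !IHs, eqm_repeat.
transitivity ((esf s d.+1 + esf s d * u x) * (esf s 1 + u x) +
  (u x * esf s d.+1 - esf s d.+1 * u x
  + esf s d * esf s 1 * u x - esf s d * u x * esf s 1)
  - esf s d * (u x * u x)); first non_commutative_ring.
rewrite -> xs, eqm_repeat2; non_commutative_ring.
Qed.

(** Column expansion for two rows leaves a factor e_1 to the right of each first-row entry;
    commutation brings it to the front. *)
Lemma hessenberg_sum_esf1 s p q : pairwise lt s ->
  hessenberg_sum (fun j => esf s (p + j) * esf s 1) (gsf s) q ===
  esf s 1 * hook_schur s p q.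
Proof.
move=> prs; rewrite /hook_schur; elim: q p => [|q IHq] p /=.
  by symmetry; apply: esf1_comm.
rewrite -> (@eq_hessenberg_sum (fun j => esf s (p + j.+1) * esf s 1)
  (fun j => esf s (p.+1 + j) * esf s 1) (gsf s) (gsf s) q).
- rewrite -> IHq, <- (esf1_comm (p + 0) prs).
  rewrite -> (@eq_hessenberg_sum (fun j => esf s (p + j.+1))
    (fun j => esf s (p.+1 + j)) (gsf s) (gsf s) q).
  + non_commutative_ring.
  + by move=> j; rewrite addnS; reflexivity.
  + by move=> j; reflexivity.
- by move=> j; rewrite addnS; reflexivity.
- by move=> j; reflexivity.
Qed.

Lemma monpos_gsf1 s d : monpos (gsf s 1 * gsf s d.+1 - gsf s d.+2).
Proof.
apply: monpos_eqm (monpos_hook_schur s 1 d) _; rewrite -/(eqm _ _).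
by symmetry; apply: hook_schur2.
Qed.

(** The expression is W(x,s) for a = d + 2. *)
Lemma monpos_gsf2_cons x s d : pairwise lt (x :: s) ->
  monpos (gsf s 2 * u x * gsf s d.+1 + u x * gsf s 1 * gsf s d.+2
        - gsf s 1 * u x * gsf s d.+2 - u x * gsf s d.+3).
Proof.
elim: s => [_|y s IHs prxs].
  by apply: monpos_eqm monpos0 _; rewrite -/(eqm _ _) !gsf_nil; non_commutative_ring.
have [ltxy ltxs ltys prs] : [/\ lt x y, all (lt x) s, all (lt y) s & pairwise lt s].
  by move: prxs; rewrite /= => /and3P[/andP[]].
apply: (@monpos_sum _ (gsf s 2 * u x * u y * gsf s d
                    + u y * u x * (gsf s 1 * gsf s d.+1 - gsf s d.+2)) _ (IHs _)).
- by rewrite /= ltxs prs.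
- apply: monposD; apply: monposM; do ?apply: monposM;
    do ?exact: monpos_gsf; do ?exact: monpos_letter; exact: monpos_gsf1.
have := eqm_comm1 ltxy ltys; rewrite !esf1 => xyc.
rewrite !gsf_cons gsf0 mulr1.
set g := gsf s in xyc *.
transitivity (
  (g 2 * u x * g d.+1 + u x * g 1 * g d.+2 - g 1 * u x * g d.+2 - u x * g d.+3)
  + g 2 * u x * u y * g d + u y * u x * (g 1 * g d.+1 - g d.+2)
  + (u y * g 1 * u x + u x * g 1 * u y - u y * u x * g 1 - g 1 * u x * u y) * g d.+1
  + u y * (g 1 * u x) * u y * g d + u x * (u y * u y) * g d.+1
  - u y * u x * u y * g d.+1).
  non_commutative_ring.
rewrite -> xyc, !eqm_repeat, eqm_repeat2; non_commutative_ring.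
Qed.

Lemma monpos_gsf2 s d : pairwise lt s ->
  monpos (gsf s 2 * gsf s d.+2 - gsf s 1 * gsf s d.+3).
Proof.
elim: s => [_|x s IHs prxs].
  by apply: monpos_eqm monpos0 _; rewrite -/(eqm _ _) !gsf_nil; non_commutative_ring.
have prs : pairwise lt s by move: prxs; rewrite pairwise_cons => /andP[].
apply: (monpos_sum (IHs prs) (monpos_gsf2_cons d prxs)).
rewrite !gsf_cons gsf0 mulr1.
set g := gsf s.
transitivity (g 2 * g d.+2 - g 1 * g d.+3
  + (g 2 * u x * g d.+1 + u x * g 1 * g d.+2 - g 1 * u x * g d.+2 - u x * g d.+3)
  + u x * g 1 * u x * g d.+1 - (u x * u x) * g d.+2).
  non_commutative_ring.
rewrite -> eqm_repeat, eqm_repeat2; non_commutative_ring.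
Qed.

(** The recursion trades P(3,d) for e_2 g_(d+1) - P(2,d+1), and [hook_schur2] removes the remaining
    hooks. The terms in e_2 g_1 g_(d+1) cancel by commutation, and e_2 = g_1 g_1 - g_2 gives the
    rest. *)
Lemma two_row_gsf s d : pairwise lt s ->
  esf s 2 * hook_schur s 2 d
  - hessenberg_sum (fun j => esf s (3 + j) * esf s 1) (gsf s) d ===
  gsf s 2 * gsf s d.+2 - gsf s 1 * gsf s d.+3.
Proof.
move=> prs; rewrite -> (hessenberg_sum_esf1 3 d prs).
have h3 := hook_schurS s 2 d.
have h2 := hook_schur2 s d; have h2S := hook_schur2 s d.+1.
have g2 : gsf s 2 === gsf s 1 * gsf s 1 - esf s 2.
  rewrite <- (hook_schur1 s 1), hook_schurS; rewrite hook_schur0 esf1; reflexivity.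
have comm : gsf s 1 * esf s 2 === esf s 2 * gsf s 1.
  by rewrite -esf1; apply: esf1_comm.
rewrite esf1; transitivity (
  esf s 2 * hook_schur s 2 d - gsf s 1 * esf s 2 * gsf s d.+1 + gsf s 1 *
   (esf s 2 * gsf s d.+1 - hook_schur s 3 d)); first non_commutative_ring.
rewrite <- h3; rewrite -> h2, h2S, g2, comm; non_commutative_ring.
Qed.

(** In the expansion along column 0, the first minor is the case f j = e_(1+j), hence g_n for size
    n; the second is the same matrix with f shifted, since the entry below f 0 is 1. *)
Lemma det_jt_tail s f n :
  noncomm_det n.+1 (jt_tail s f) === hessenberg_sum f (gsf s) n.
Proof.
elim: n f => [|n IHn] f; first by rewrite noncomm_det1; reflexivity.
rewrite noncomm_det_col0 //.
rewrite (@eq_noncomm_det _ _ _ (jt_tail s (fun j => esf s (1 + j)))); last first.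
  by move=> [|i] j _ _; rewrite /= ?ecoefSS.
rewrite [X in _ - X](@eq_noncomm_det _ _ _ (jt_tail s (fun j => f j.+1))); last first.
  by move=> [|i] j _ _; rewrite /= ?ecoefSS // /ecoef esf0 mulr1.
rewrite -> !IHn; rewrite -/(hook_schur s 1 n).
rewrite -> (hook_schur1 s n); reflexivity.
Qed.

Lemma monpos_det_hook s p q :
  monpos (noncomm_det q.+1 (jt_tail s (fun j => esf s (p.+1 + j)))).
Proof. exact: monpos_eqm (monpos_hook_schur s p q) (det_jt_tail _ _ _). Qed.

(** This is the Jacobi-Trudi matrix of (n + 2, 2). Its entry e_1 in row 1, column 0 multiplies the
    first row of the second minor. *)
Lemma monpos_det_two_row s n : pairwise lt s ->
  monpos (noncomm_det n.+2 (fun i j =>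
    match i with 0 => esf s (2 + j) | 1 => esf s (1 + j) | _ => ecoef s i.-1 j end)).
Proof.
move=> prs; apply: monpos_eqm (monpos_gsf2 n prs) _; rewrite -/(eqm _ _).
rewrite <- (two_row_gsf n prs).
rewrite noncomm_det_col0 //.
rewrite (@eq_noncomm_det _ _ _ (jt_tail s (fun j => esf s (2 + j)))); last first.
  by move=> [|i] j _ _; rewrite /= ?ecoefSS.
rewrite [X in _ - X](@eq_noncomm_det _ _ _
  (jt_tail s (fun j => esf s (3 + j) * esf s 1))); last first.
  by move=> [|i] j _ _; rewrite /= ?ecoefSS.
rewrite -> !det_jt_tail; reflexivity.
Qed.

End Congruence.

(** * Reversal of words *)

Section ConverseRing.
Local Open Scope ring_scope.

Variables (R : nzRingType) (T : Type) (u : T -> R) (I : R -> Prop).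

Lemma gsf_converse s d : @gsf R^c T u s d = esf u s d.
Proof. by elim: s d => [|x s IHs] [|d] //=; rewrite !IHs. Qed.

Lemma monpos_converse x : @monpos R^c T u I x -> monpos u I x.
Proof.
elim=> {x}.
- exact: monpos0.
- exact: monpos1.
- exact: monpos_letter.
- by move=> x y _ Px _ Py; exact: monposD.
- by move=> x y _ Px _ Py; exact: monposM Py Px.
- by move=> x y _ Px Ixy; apply: monpos_eqm Px Ixy.
Qed.

(* Reversal of words exchanges esf and gsf and preserves the hypotheses on I, so
   this is monpos_gsf2 in the converse ring. *)
Lemma monpos_esf2 (lt : rel T) s d :
  I 0 -> (forall x y, I x -> I y -> I (x + y)) ->
  (forall r x, I x -> I (r * x)) -> (forall r x, I x -> I (x * r)) ->
  (forall a x, I (u a * x * u a)) ->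
  (forall a b c, lt a b -> lt b c ->
     I (u b * (u a * u c - u c * u a) - (u a * u c - u c * u a) * u b)) ->
  pairwise lt s ->
  monpos u I (esf u s d.+2 * esf u s 2 - esf u s d.+3 * esf u s 1).
Proof.
move=> I0 ID IMl IMr I_repeat I_comm prs; apply: monpos_converse.
rewrite -!gsf_converse; apply: (@monpos_gsf2 R^c T u lt I) => //.
- by move=> a x; have := I_repeat a x; rewrite -mulrA.
move=> a b c ltab ltbc; have := I_comm a b c ltab ltbc.
(* Reversal negates the commutator and swaps the sides of [u b], so it fixes the relation. *)
set z := u a * u c - u c * u a; rewrite (_ : _ - _ = - z * u b - u b * - z).
  by rewrite opprB.
by rewrite mulNr mulrN opprK addrC.
Qed.

End ConverseRing.

(** * Enumeration of strictly decreasing words *)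

Section DecreasingWords.
Local Open Scope ring_scope.

(** Makes the index set behind the recursion of [esf] explicit, for comparison with the sum over
    tuples in [elem]. *)
Fixpoint decreasing_words (T : Type) (s : seq T) (d : nat) : seq (seq T) :=
  match d, s with
  | 0, _ => [:: [::]]
  | _.+1, [::] => [::]
  | d'.+1, x :: s' =>
      decreasing_words s' d ++ [seq rcons w x | w <- decreasing_words s' d']
  end.

Lemma esf_decreasing_words (R : nzRingType) (T : Type) (u : T -> R) s d :
  esf u s d = \sum_(w <- decreasing_words s d) \prod_(i <- w) u i.
Proof.
elim: s d => [|x s IHs] [|d] /=; rewrite ?big_seq1 ?big_nil //.
rewrite big_cat big_map !IHs mulr_suml; congr (_ + _).
by apply: eq_bigr => w _; rewrite big_rcons.
Qed.

Lemma mem_decreasing_words (T : eqType) (s : seq T) d w :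
  (w \in decreasing_words s d) = (size w == d) && subseq (rev w) s.
Proof.
elim: s d w => [|x s IHs] [|d] w /=.
- by rewrite inE; case: w.
- by case/lastP: w => [|w y]; rewrite // rev_rcons andbF.
- by rewrite inE; case: w.
rewrite mem_cat IHs; case/lastP: w => [|w y] /=.
  by apply/negP=> /mapP[w _]; case: w.
rewrite rev_rcons size_rcons eqSS /=; have [->|/eqP neyx] := eqVneq y x.
  rewrite (mem_map (@rcons_injl _ x)) IHs -andb_orr; congr (_ && _).
  by apply/orb_idl => /cons_subseq.
rewrite [X in _ || X](_ : _ = false) ?orbF //.
by apply/negP=> /mapP[w' _ /rcons_inj[_ /neyx]].
Qed.

Lemma uniq_decreasing_words (T : eqType) (s : seq T) d :
  uniq s -> uniq (decreasing_words s d).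
Proof.
elim: s d => [|x s IHs] [|d] //= /andP[xs us].
rewrite cat_uniq IHs // (map_inj_uniq (@rcons_injl _ x)) IHs // andbT /=.
apply/hasPn => _ /mapP[w _ ->]; rewrite mem_decreasing_words negb_and.
apply/orP; right; apply: contra xs => /mem_subseq; apply.
by rewrite mem_rev mem_rcons mem_head.
Qed.

End DecreasingWords.

(** * The free algebra and its ideal *)

Section FreeAlgebra.
Local Open Scope ring_scope.

Variable N : nat.
Let ltI (i j : 'I_N) := (i < j)%N.

Lemma sorted_enum_ord : sorted ltI (enum 'I_N).
Proof. by have := iota_ltn_sorted 0 N; rewrite -val_enum_ord sorted_map. Qed.

Lemma ltI_trans : transitive ltI.
Proof. by move=> ? ? ?; apply: ltn_trans. Qed.

Lemma subseq_enum_ord (w : seq 'I_N) : subseq w (enum 'I_N) = sorted ltI w.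
Proof.
apply/idP/idP => [/(subseq_sorted ltI_trans)|sw]; first by apply; exact: sorted_enum_ord.
rewrite (@irr_sorted_eq _ ltI ltI_trans _ w (filter (mem w) (enum 'I_N))).
- exact: filter_subseq.
- by move=> i; rewrite /ltI ltnn.
- exact: sw.
- by apply: sorted_filter sorted_enum_ord; exact: ltI_trans.
- by move=> i; rewrite mem_filter mem_enum andbT.
Qed.

Lemma elem_esf d : elem N (Posz d) = esf (@letter N) (enum 'I_N) d.
Proof.
rewrite esf_decreasing_words /elem /word.
rewrite -big_enum -(big_map val predT (fun w => \prod_(i <- w) letter i)).
apply: perm_big; apply: uniq_perm.
- by rewrite (map_inj_uniq val_inj) enum_uniq.
- exact/uniq_decreasing_words/enum_uniq.
move=> w; rewrite mem_decreasing_words subseq_enum_ord rev_sorted.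
apply/mapP/andP => [[t] | [/eqP sw sorted_w]].
  by rewrite mem_enum => sorted_t ->; rewrite size_tuple.
exists (tcast sw (in_tuple w)); last by rewrite /= val_tcast.
by rewrite mem_enum /in_mem /= val_tcast.
Qed.

Lemma word_cat (v w : seq 'I_N) : word (v ++ w) = word v * word w.
Proof. by rewrite /word big_cat. Qed.

Lemma mmon_word (k : {fmonom 'I_N}) : << k >> = word k :> free_alg N.
Proof.
case: k => w; rewrite /=; elim: w => [|i w IHw].
  by rewrite /word big_nil -fmoneE.
rewrite /word big_cons -/(word w) -IHw /letter malgM_def fgmulUU mulr1.
by congr << _ >>; apply: val_inj; rewrite /= fmM fmU.
Qed.

(** The generators are single words, so x is expanded into monomials; each gives a multiple of a
    word with equal end letters. *)
Lemma I_KRst_repeat (i : 'I_N) x : I_KRst (letter i * x * letter i).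
Proof.
rewrite (monalgE x) mulr_sumr mulr_suml.
elim/big_ind: _ => [|y z|k _]; [exact: ideal_gen0 | exact: ideal_genD |].
rewrite (_ : _ * _ = (x@_k)%:MP * word (i :: k ++ [:: i])).
  by apply/ideal_genMl/ideal_gen_base/KRst_gen_repeat; rewrite /= mem_cat mem_head orbT.
rewrite -cat1s !word_cat -mmon_word /word big_seq1 /letter !malgM_def !fgmulUU.
by rewrite mul1r !mulr1 mul1m mulmA.
Qed.

Lemma I_KRst_comm (a b c : 'I_N) : ltI a b -> ltI b c ->
  I_KRst (letter b * (letter a * letter c - letter c * letter a)
          - (letter a * letter c - letter c * letter a) * letter b).
Proof.
move=> ltab ltbc; have := KRst_gen_comm ltab ltbc.
by rewrite /word !big_cons !big_nil !mulr1; apply: ideal_gen_base.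
Qed.

Lemma monpos_positive_monomial_sum x :
  monpos (@letter N) (@I_KRst N) x -> positive_monomial_sum_mod (@I_KRst N) x.
Proof.
elim=> {x}.
- by exists [::]; rewrite big_nil subr0; exact: ideal_gen0.
- by exists [:: (1%N, [::])]; rewrite big_seq1 /word big_nil subrr; exact: ideal_gen0.
- move=> i; exists [:: (1%N, [:: i])].
  by rewrite big_seq1 /word big_seq1 subrr; exact: ideal_gen0.
- move=> x y _ [v Iv] _ [w Iw]; exists (v ++ w).
  by rewrite big_cat opprD addrACA; exact: ideal_genD.
- move=> x y _ [v Iv] _ [w Iw].
  exists [seq (s.1 * t.1, s.2 ++ t.2)%N | s <- v, t <- w].
  set p := \sum_(t <- v) _ in Iv; set q := \sum_(t <- w) _ in Iw.
  rewrite (_ : \sum_(t <- _) _ = p * q); last first.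
    rewrite big_allpairs_dep big_distrlr; apply: eq_bigr => s _; apply: eq_bigr => t _.
    by rewrite /= word_cat mulrnAl mulrnAr -mulrnA mulnC.
  rewrite -(subrKA (p * y)) -mulrBl -mulrBr.
  by apply: ideal_genD; [exact: ideal_genMr | exact: ideal_genMl].
- move=> x y _ [v Iv] Ixy; exists v; rewrite -(subrKA x).
  exact: ideal_genD.
Qed.

Lemma elem_subz (k i j d : nat) : (k + j = d + i)%N ->
  elem N (k%:Z + j%:Z - i%:Z) = esf (@letter N) (enum 'I_N) d.
Proof. by move=> e; rewrite -PoszD e PoszD addrK elem_esf. Qed.

Lemma elem_ecoef (i j : nat) :
  elem N (1%:Z + j%:Z - (i.+1)%:Z) = ecoef (@letter N) (enum 'I_N) i j.
Proof.
rewrite /ecoef; case: leqP => [leij | ltji].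
  by apply: elem_subz; rewrite addnS subnK.
rewrite (intS i) opprD addrACA subrr add0r -[_ - _]opprB subzn 1?ltnW //.
by rewrite -(subnSK ltji) -NegzE.
Qed.

Lemma pairwise_enum_ord : pairwise ltI (enum 'I_N).
Proof. by rewrite -(sorted_pairwise ltI_trans) sorted_enum_ord. Qed.

Lemma ncschur_det la : ncschur N la =
  noncomm_det (head 0%N la)
    (fun i j => elem N ((conj_part la i)%:Z + j%:Z - i%:Z)).
Proof. by []. Qed.

End FreeAlgebra.

(** * The three families of shapes *)

Theorem theorem1p3 (N : nat) (la : seq nat) :
  0 < N ->
  is_partition la ->
  (exists a b : nat, la = a :: nseq b 1) \/
  (exists a : nat, 2 <= a /\ la = [:: a; 2]) \/
  (exists a : nat, la = 2 :: 2 :: nseq a 1) ->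
  positive_monomial_sum_mod (@I_KRst N) (ncschur N la).
Proof.
move=> _ partla shape; apply: monpos_positive_monomial_sum; rewrite ncschur_det.
have I0 := ideal_gen0 (@KRst_gen N).
have ID := @ideal_genD _ (@KRst_gen N).
have IMl := @ideal_genMl _ (@KRst_gen N).
have IMr := @ideal_genMr _ (@KRst_gen N).
have Irep := @I_KRst_repeat N.
have Icomm := @I_KRst_comm N.
have prN := pairwise_enum_ord N.
case: shape => [[a [b def_la]] | [[a [le2a def_la]] | [a def_la]]].
- case: a def_la => [|q] def_la.
    (* A hook with a = 0 would have a zero part. *)
    by rewrite def_la /is_partition inE andbF in partla.
  rewrite def_la (@eq_noncomm_det _ _ _ (jt_tail (@letter N) (enum 'I_N)
    (fun j => esf (@letter N) (enum 'I_N) (b.+1 + j)))).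
    exact: monpos_det_hook.
  move=> [|i] j lti _.
    by apply: elem_subz; rewrite /conj_part /= count_nseq mul1n addn0.
  rewrite (_ : conj_part _ _ = 1); first exact: elem_ecoef.
  by rewrite /conj_part /= count_nseq addn0 lti.
- case: a le2a def_la => [|[|n]] // _ def_la.
  rewrite def_la (@eq_noncomm_det _ _ _ (fun i j => match i with
    | 0 => esf (@letter N) (enum 'I_N) (2 + j)
    | 1 => esf (@letter N) (enum 'I_N) (1 + j)
    | _ => ecoef (@letter N) (enum 'I_N) i.-1 j end)).
    exact: (monpos_det_two_row I0 ID IMl IMr Irep Icomm n prN).
  move=> [|[|i]] j lti _; first by apply: elem_subz; rewrite addn0.
    by apply: elem_subz; rewrite addn1.
  rewrite (_ : conj_part _ _ = 1); first exact: elem_ecoef.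
  by rewrite /conj_part /= lti.
(* The determinant has size 2; the value 0 in lower rows only serves the hypothesis of
   [noncomm_det_col0]. *)
- rewrite def_la (@eq_noncomm_det _ _ _ (fun i j => match i with
    | 0 => esf (@letter N) (enum 'I_N) (a.+2 + j)
    | 1 => esf (@letter N) (enum 'I_N) (1 + j)
    | _ => 0%R end)).
    rewrite noncomm_det_col0 // !noncomm_det1 !addn0 !addn1.
    exact: (monpos_esf2 a I0 ID IMl IMr Irep Icomm prN).
  move=> [|[|i]] j // _ _; apply: elem_subz.
    by rewrite /conj_part /= count_nseq mul1n addn0.
  by rewrite /conj_part /= count_nseq addn1.
Qed.
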